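(* Let $n\ge 1$. The composite map $\gamma\circ\phi\circ\mathbf f$ is a bijection from $\mathcal D_n$ to $\mathcal F_n^{\mathrm{bi}}$, where $\mathcal D_n$ is the set of bicolored binary trees on $[n]$ all of whose improper vertices are black, $\mathcal F_n^{\mathrm{bi}}$ is the set of bicolored (rooted, labeled) forests on $[n]$, and the maps $\mathbf f$ (simultaneous flip at all right improper vertices), $\phi$ (the restriction to $\mathcal E_n$ of the left-child/right-sibling correspondence $\Phi$) and $\gamma$ (deletion of the root $n+1$) are as defined in the context.
   Context: All trees are labeled and rooted. $[n]=\{1,\dots,n\}$. A tree on a finite set $V$ is an acyclic connected graph with vertex set $V$ and a distinguished vertex, the root. A forest on $[n]$ is a graph on $[n]$ each of whose connected components is a (rooted) tree. A vertex $j$ is a descendant of $i$ if $i$ lies on the path from $j$ to the root of the component of $j$ (so $i$ is a descendant of itself); a descendant $j$ of $i$ joined to $i$ by an edge is a child of $i$. $S(T,i)$ is the induced subtree on the descendants of $i$, rooted at $i$. A vertex $i$ is proper if $i$ is the smallest vertex of $S(T,i)$, and improper otherwise. A graph is bicolored if each vertex is colored black or white. $\mathcal F_n^{\mathrm{bi}}$ is the set of bicolored forests on $[n]$. A binary tree is a tree in which each vertex has at most two children and each child is designated as the left or the right child of its parent (with at most one of each). $\mathcal B_n^{\mathrm{bi}}$ is the set of bicolored binary trees on $[n]$. $\mathcal D_n\subseteq\mathcal B_n^{\mathrm{bi}}$ consists of those in which each proper vertex is black or white and each improper vertex is black. For $B\in\mathcal B_n^{\mathrm{bi}}$ and a vertex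 $v$, $L(B,v)$ (resp. $R(B,v)$) is the descendant subtree rooted at the left (resp. right) child of $v$, possibly empty. $m(T)$ is the smallest vertex of $T$, with $m(\emptyset)=\infty$. An improper vertex $v$ of $B$ is right improper if $m(L(B,v))>m(R(B,v))$, and left improper otherwise. The flip $f_v$ swaps $L(B,v)$ and $R(B,v)$ (as left and right subtrees of $v$) and changes the color of $v$; flips at different vertices commute. For $D\in\mathcal D_n$, $\mathbf f(D)=(f_{v_1}\circ\cdots\circ f_{v_k})(D)$, where $\{v_1,\dots,v_k\}$ is the set of right improper vertices of $D$. $\mathcal E_n\subseteq \mathcal B_n^{\mathrm{bi}}$ is the set of bicolored binary trees $E$ on $[n]$ in which every improper vertex $v$ is left improper, i.e. $m(L(E,v))<m(R(E,v))$; the map $\mathbf f$ takes values in $\mathcal E_n$. A plane tree is a tree in which the children of each vertex are linearly ordered. $\mathcal G_n$ (resp. $\mathcal Q_n$) is the set of bicolored trees (resp. bicolored plane trees) on $[n+1]$ whose root is $n+1$, colored black. $\mathcal G_n$ is identified with the subset of $\mathcal Q_n$ consisting of those $Q$ such that for every non-leaf vertex $v$ with children $(w_1,\dots,w_r)$ in order, $m(S(Q,w_1))<\cdots<m(S(Q,w_r))$. The bijection $\Phi:\mathcal B_n^{\mathrm{bi}}\to\mathcal Q_n$, $B\mapsto Q$, is determined by: the vertices of $B$ are the vertices of $Q$ other than the root $n+1$; the root of $B$ is the first child of the black root $n+1$ of $Q$; $v$ is the left child of $u$ in $B$ iff $v$ is the first child of $u$ in $Q$; $v$ is the right child of $u$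 in $B$ iff $v$ is the sibling immediately to the right of $u$ in $Q$; colors of the vertices in $[n]$ are preserved. $\phi$ is the restriction of $\Phi$ to $\mathcal E_n$; it takes values in $\mathcal G_n$. $\gamma:\mathcal G_n\to\mathcal F_n^{\mathrm{bi}}$ sends a tree to the forest obtained by removing the vertex $n+1$ and making each neighbor of $n+1$ a root, keeping the colors of the vertices in $[n]$. *)

(* Defs.v *)
(* Vertex sets are ordinals, with 'I_n standing for
   [n] = {1, ..., n} through the order isomorphism i |-> i + 1, so that the
   vertex n + 1 of [n + 1] is ord_max : 'I_n.+1. *)
From mathcomp Require Import all_boot.
From mathcomp Require Import classical_sets functions.

Set Implicit Arguments.
Unset Strict Implicit.
Unset Printing Implicit Defensive.

Local Open Scope classical_set_scope.

(* Colors are booleans: true is black, false is white. *)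
Definition black : bool := true.

(** * Bicolored binary trees *)

(* A possibly empty binary tree: left subtree, root label, root color,
   right subtree. *)
Inductive bintree (V : Type) : Type :=
| Leaf
| Node (l : bintree V) (v : V) (c : bool) (r : bintree V).
Arguments Leaf {V}.

Section BinaryTrees.
Variable n : nat.
Implicit Types (B : bintree 'I_n) (v : 'I_n).

Fixpoint bnodes B : seq ('I_n * bool) :=
  if B is Node l v c r then (v, c) :: bnodes l ++ bnodes r else [::].

Definition blabels B : seq 'I_n := [seq x.1 | x <- bnodes B].

(* Each vertex of [n] labels exactly one node. *)
Definition Bbi : set (bintree 'I_n) :=
  [set B | perm_eq (blabels B) (enum 'I_n)].

(* S(B, v); the empty tree if v is not a vertex of B. *)
Fixpoint bsub B v : bintree 'I_n :=
  if B is Node l u c r then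
    if u == v then B
    else if v \in blabels l then bsub l v else bsub r v
  else Leaf.

Definition bleft B v : bintree 'I_n :=
  if bsub B v is Node l _ _ _ then l else Leaf.

Definition bright B v : bintree 'I_n :=
  if bsub B v is Node _ _ _ r then r else Leaf.

(* The smallest vertex m(B); all vertices are < n, so n plays the role of
   m(empty) = infinity. *)
Definition bmin B : nat := \big[minn/n]_(u <- blabels B) (u : nat).

Definition proper_vertex B v : bool :=
  all (fun u : 'I_n => v <= u) (blabels (bsub B v)).

Definition right_improper B v : bool :=
  ~~ proper_vertex B v && (bmin (bright B v) < bmin (bleft B v)).

Definition Dbi : set (bintree 'I_n) :=
  [set B | Bbi B /\ forall v, ~~ proper_vertex B v -> (v, black) \in bnodes B].

Fixpoint flip v B : bintree 'I_n :=
  if B is Node l u c r then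
    if u == v then Node r u (~~ c) l
    else Node (flip v l) u c (flip v r)
  else Leaf.

(* The set of right improper vertices is computed once, in the original tree;
   the order of composition is irrelevant because flips commute. *)
Definition flip_right_improper B : bintree 'I_n :=
  foldr flip B [seq v <- blabels B | right_improper B v].

End BinaryTrees.

(** * Bicolored plane trees and the left-child/right-sibling correspondence *)

Inductive ptree (V : Type) : Type :=
| PNode (v : V) (c : bool) (ts : seq (ptree V)).

Definition proot (V : Type) (Q : ptree V) : V := let: PNode v _ _ := Q in v.

Fixpoint pnodes (V : Type) (Q : ptree V) : seq (V * bool) :=
  let: PNode v c ts := Q in (v, c) :: flatten [seq pnodes t | t <- ts].

(* The pairs (parent, child). *)
Fixpoint pedges (V : Type) (Q : ptree V) : seq (V * V) :=
  let: PNode v _ ts := Q in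
  [seq (v, proot t) | t <- ts] ++ flatten [seq pedges t | t <- ts].

(* [psiblings B] lists the subtrees of Phi(B) at the root of B and at its
   siblings to the right: the left subtree of a vertex yields its children
   (the left child first), the right subtree yields the siblings following it
   (the right child first). *)
Fixpoint psiblings (n : nat) (B : bintree 'I_n) : seq (ptree 'I_n.+1) :=
  if B is Node l v c r then
    PNode (widen_ord (leqnSn n) v) c (psiblings l) :: psiblings r
  else [::].

Definition Phi (n : nat) (B : bintree 'I_n) : ptree 'I_n.+1 :=
  PNode ord_max black (psiblings B).

(** * Bicolored rooted graphs, trees and forests *)

(* A graph on V (edges are sets of vertices, required to have cardinality 2
   by [is_forest] below) with distinguished roots and a coloring. *)
Record rgraph (V : finType) : Type := RGraph {
  edges : {set {set V}};
  roots : {set V};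
  color : {ffun V -> bool}
}.

Definition adj (V : finType) (F : rgraph V) : rel V :=
  fun x y => [set x; y]%SET \in edges F.

(* Simple acyclic graph with exactly one root in each connected component. *)
Definition is_forest (V : finType) (F : rgraph V) : Prop :=
  [/\ forall e : {set V}, e \in edges F -> #|e| = 2,
      forall c : seq V, ucycle (adj F) c -> size c <= 2
    & forall v : V, exists! r : V, r \in roots F /\ connect (adj F) v r].

Definition Fbi (n : nat) : set (rgraph 'I_n) := [set F | is_forest F].

(* The rooted tree obtained by forgetting the order of the children; it is the
   inverse of the identification of bicolored rooted trees with the plane trees
   in which siblings w_1, ..., w_r satisfy m(S(Q,w_1)) < ... < m(S(Q,w_r)). *)
Definition unplane (V : finType) (Q : ptree V) : rgraph V :=
  {| edges := [set [set e.1; e.2] | e in pedges Q]%SET;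
     roots := [set proot Q]%SET;
     color := [ffun v => (v, black) \in pnodes Q] |}.

(* Total on all binary trees; only its values on the trees whose improper
   vertices are all left improper (the values of [flip_right_improper] on
   [Dbi]) matter. *)
Definition phi (n : nat) (E : bintree 'I_n) : rgraph 'I_n.+1 :=
  unplane (Phi E).

(* Deletion of the vertex n + 1, whose neighbors become the roots. *)
Definition gamma (n : nat) (T : rgraph 'I_n.+1) : rgraph 'I_n :=
  let w := widen_ord (leqnSn n) in
  {| edges := [set e : {set 'I_n} | [set w x | x in e] \in edges T]%SET;
     roots := [set v | adj T ord_max (w v)]%SET;
     color := [ffun v => color T (w v)] |}.

(* Main.v *)
From mathcomp Require Import classical_sets functions.
From mathcomp Require Import all_boot zify.
Require Import Defs.

(** The map is a composite of two bijections, through the set [Ebi] of bicolored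
    binary trees without right improper vertices.

    From [Dbi] to [Ebi] ([set_bij_flip]). A flip swaps two subtrees and changes
    one color; it changes neither the descendant set of any vertex nor its
    minimum, so proper vertices stay proper. In [Dbi] improper vertices are black.
    The flips at the right improper vertices make these left improper and white,
    while the other improper vertices stay left improper and black. Hence the
    color of an improper vertex of the image records whether it was flipped, and
    flipping back all white improper vertices is the inverse.

    From [Ebi] to [Fbi] ([set_bij_graph]). Having no right improper vertex means
    ([ordered]) that siblings of the plane forest come in increasing order of the
    minima of their subtrees. So [Ebi] consists of codes of rooted forests in
    which the order of siblings is forced by the forest, and every forest has
    exactly one such code. In terms of graphs: deleting a root [v] splits a rooted
    forest into the forest on the rest of the component of [v], rooted at the
    neighbors of [v], and the forest on the other components; conversely two such
    pieces glue back to a rooted forest ([rooted_forest_children],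
    [rooted_forest_tail], [rooted_forest_join]). This matches the decomposition of
    a binary tree into its root and its left and right subtrees
    ([realizes_nodeE], [realizes_nodeI]). In an ordered code [v] must be the root
    of the component that contains the smallest vertex, so recursion on the pieces
    gives existence ([realizes_exists]) and uniqueness ([realizes_unique]) of the
    code. Working with undirected adjacency on both sides means that edges never
    have to be oriented in the given forest. *)

Set Implicit Arguments.
Unset Strict Implicit.
Unset Printing Implicit Defensive.

(** * Rooted forests and their decomposition at a root *)

Section Forests.
Variables (V : finType) (e : rel V).
Hypothesis e_sym : symmetric e.
Implicit Types (A C S : {set V}) (u v x y : V).

Definition induced A : rel V := fun x y => [&& x \in A, y \in A & e x y].

(** The vertex set [A] is carried along, with the graph fixed, so that a forest
    and the pieces obtained by deleting a root all live on the same type. The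
    cycles are those of [e], not of [induced A], because [ucycle] with support
    in [A] says the same and transfers to smaller sets at no cost. *)
Record rooted_forest A S : Prop := RootedForest {
  forest_roots : S \subset A;
  forest_acyclic : forall c, ucycle e c -> {subset c <= A} -> size c <= 2;
  forest_root_ex : forall u, u \in A ->
    exists2 r, r \in S & connect (induced A) u r;
  forest_root_uniq : {in S &, forall r s, connect (induced A) r s -> r = s}
}.

(** Closure under the edges within [A] makes [C] a union of components of the
    graph induced on [A]; when that graph is a forest, [C] is the component of
    [v], see [forest_component]. *)
Record root_component A S v C : Prop := RootComponent {
  comp_root : v \in S;
  comp_mem : v \in C;
  comp_sub : C \subset A;
  comp_uniq : forall s, s \in S -> s \in C -> s = v;
  comp_closed : forall x y, x \in C -> y \in A -> e x y -> y \in C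
}.

Definition child_roots v C := [set y in C :\ v | e v y].

Lemma induced_sym A : symmetric (induced A).
Proof. by move=> x y; rewrite /induced e_sym; case: (x \in A); case: (y \in A). Qed.

Lemma connect_induced_sub A C x y : C \subset A ->
  connect (induced C) x y -> connect (induced A) x y.
Proof.
move=> /subsetP sCA; apply: connect_sub => a b /and3P[aC bC eab].
by apply: connect1; rewrite /induced !sCA.
Qed.

Lemma path_closed C (D : pred V) x p :
    (forall a b, a \in C -> D b -> e a b -> b \in C) ->
  x \in C -> all D p -> path e x p -> path (induced C) x p.
Proof.
move=> closed; elim: p x => //= y p IHp x xC /andP[Dy Dp] /andP[exy pth].
have yC := closed _ _ xC Dy exy.
by rewrite {1}/induced xC yC exy IHp.
Qed.

Lemma path_induced C x p : path (induced C) x p -> path e x p /\ {subset p <= C}.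
Proof.
elim: p x => [//|y p IHp] x /= /andP[/and3P[_ yC exy] /IHp[-> sub]].
by rewrite exy; split=> // z; rewrite inE => /predU1P[->|/sub].
Qed.

Lemma connect_closed A C x y :
    (forall a b, a \in C -> b \in A -> e a b -> b \in C) ->
  x \in C -> connect (induced A) x y -> y \in C /\ connect (induced C) x y.
Proof.
move=> closed xC /connectP[p /path_induced[pth sub] ->].
have pthC : path (induced C) x p.
  by apply: (path_closed closed) => //; apply/allP.
split; last by apply/connectP; exists p.
have [_ subC] := path_induced pthC.
by have := mem_last x p; rewrite inE => /predU1P[->|/subC].
Qed.

Lemma component_compl A S v C : root_component A S v C ->
  forall x y, x \in A :\: C -> y \in A -> e x y -> y \in A :\: C.
Proof.
case=> _ _ _ _ closed x y /setDP[xA xC] yA exy; rewrite inE yA andbT.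
by apply: contra xC => yC; apply: closed yC xA _; rewrite e_sym.
Qed.

(** The component is thus determined by the graph and [v] alone: this is what
    makes the decomposition of a forest at a root unique. *)
Lemma forest_component A S v C : rooted_forest A S -> root_component A S v C ->
  C = [set u in A | connect (induced A) u v].
Proof.
move=> [SA _ ex _] comp; have [vS vC /subsetP CA uniqC closed] := comp.
apply/setP=> u; rewrite inE; apply/idP/andP=> [uC|[uA cuv]].
  have uA := CA _ uC; split=> //; have [r rS cur] := ex u uA.
  by have [rC _] := connect_closed closed uC cur; rewrite -(uniqC r).
rewrite (sym_connect_sym (@induced_sym A)) in cuv.
by case: (connect_closed closed vC cuv).
Qed.

Lemma root_component_ex A S v : rooted_forest A S -> v \in S ->
  root_component A S v [set u in A | connect (induced A) u v].
Proof.
move=> [/subsetP SA _ ex uniqS] vS; have vA := SA _ vS; split=> //.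
- by rewrite inE vA connect0.
- by apply/subsetP=> u; rewrite inE => /andP[].
- by move=> s sS; rewrite inE => /andP[_]; apply: uniqS.
move=> x y; rewrite !inE => /andP[xA cxv] yA exy; rewrite yA.
by apply: connect_trans cxv; apply: connect1; rewrite /induced yA xA e_sym.
Qed.

Lemma rooted_forest_tail A S v C : root_component A S v C ->
  rooted_forest A S -> rooted_forest (A :\: C) (S :\ v).
Proof.
move=> comp [/subsetP SA acyc ex uniqS].
have [vS vC CA uniqC closed] := comp.
have closedD := component_compl comp.
have sDA : A :\: C \subset A by apply: subsetDl.
split.
- apply/subsetP=> s; rewrite !inE => /andP[sv sS]; rewrite SA // andbT.
  by apply: contra sv => sC; apply/eqP; apply: uniqC.
- by move=> c cyc sub; apply: acyc => // x /sub; apply: (subsetP sDA).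
- move=> u uD; have [r rS cur] := ex u (subsetP sDA _ uD).
  have [rD curD] := connect_closed closedD uD cur.
  exists r => //; rewrite !inE rS andbT.
  by apply: contraTneq rD => ->; rewrite inE vC.
move=> r s /setD1P[_ rS] /setD1P[_ sS] /(connect_induced_sub sDA).
exact: uniqS.
Qed.

(** Each [u] in [C :\ v] reaches a neighbor of [v] by following its path to the
    root [v] and stopping just before [v]. Two distinct neighbors of [v]
    connected off [v] would close, through [v], a cycle of length at least 3. *)
Lemma rooted_forest_children A S v C : root_component A S v C ->
  rooted_forest A S -> rooted_forest (C :\ v) (child_roots v C).
Proof.
move=> comp [/subsetP SA acyc ex uniqS].
have [vS vC CA uniqC closed] := comp.
split.
- by apply/subsetP=> s; rewrite inE => /andP[].
- by move=> c cyc sub; apply: acyc => // x /sub /setD1P[_]; apply: (subsetP CA).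
- move=> u /setD1P[uv uC]; have [r rS cur] := ex u (subsetP CA _ uC).
  have [rC curC] := connect_closed closed uC cur.
  rewrite (uniqC r rS rC) in curC.
  case/connectP: curC => p /shortenP[p' pth' uniqp' _ {p}].
  (* A simple path ending at [v] visits [v] only there: its other vertices lie
     in [C :\ v]. *)
  case/lastP: p' pth' uniqp' => [_ _ /esym/eqP|p w]; first by rewrite (negPf uv).
  rewrite last_rcons rcons_path -rcons_cons rcons_uniq.
  move=> /andP[pth elast] /andP[vp _] vw; rewrite -{w}vw in elast vp.
  have [pthe subC] := path_induced pth.
  have vNp : {in u :: p, forall x, x \in C :\ v}.
    move=> x xp; rewrite !inE; apply/andP; split.
      by apply: contraNneq vp => <-.
    by move: xp; rewrite inE => /predU1P[->|/subC].
  exists (last u p).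
    rewrite inE vNp ?mem_last // e_sym.
    by case/and3P: elast.
  apply/connectP; exists p => //.
  apply: (@path_closed _ (mem (C :\ v))) => //; first by rewrite vNp ?mem_head.
  by apply/allP=> x xp; apply: vNp; rewrite inE xp orbT.
move=> r s; rewrite !inE => /andP[rC evr] /andP[sC evs].
case/connectP=> p /shortenP[p' pth uniqp _ {p}] lastp.
have [pthe sub] := path_induced pth.
case: p' => [|y p] // in pth uniqp lastp pthe sub *.
have subC : {subset r :: y :: p <= C :\ v}.
  by move=> x; rewrite inE => /predU1P[->|/sub //]; rewrite !inE.
(* The forbidden cycle v, r, y, ..., s. *)
suff: size [:: v, r, y & p] <= 2 by [].
apply: acyc => [|x].
  rewrite /ucycle; apply/andP; split.
    rewrite (cycle_path v) /= evr -[last y p]/(last r (y :: p)) -lastp e_sym evs.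
    exact: pthe.
  rewrite cons_uniq uniqp andbT.
  by apply/negP=> /subC; rewrite !inE eqxx.
rewrite inE => /predU1P[->|/subC /setD1P[_]]; exact: (subsetP CA).
Qed.

(** Converse of the two preceding lemmas. A cycle off [v] stays within one of the
    two pieces. A cycle through [v], rotated to start at [v], leaves [v] by some
    [x] and comes back from some last vertex; both are children of [v] and they
    are connected off [v], so they are the same root of [C :\ v]. *)
Lemma rooted_forest_join A S v C : root_component A S v C ->
    rooted_forest (C :\ v) (child_roots v C) ->
    rooted_forest (A :\: C) (S :\ v) ->
  rooted_forest A S.
Proof.
move=> comp [_ acyc1 ex1 uniq1] [/subsetP S2 acyc2 ex2 uniq2].
have [vS vC CA uniqC closed] := comp.
have closedD := component_compl comp.
have closedC a b : a \in C :\ v -> (b \in A) && (b != v) -> e a b -> b \in C :\ v.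
  by move=> /setD1P[_ aC] /andP[bA bv] eab; rewrite !inE bv (closed a).
split.
- apply/subsetP=> s sS; have [->|sv] := eqVneq s v; first exact: (subsetP CA).
  by have /S2/setDP[] : s \in S :\ v by rewrite !inE sv.
- move=> c ucyc sub; have [vc|vNc] := boolP (v \in c).
    case/rot_to: (vc) => i c' def_c.
    have {sub}subc : {subset v :: c' <= A}.
      by move=> x; rewrite -def_c mem_rot; apply: sub.
    have : ucycle e (v :: c').
      by rewrite -def_c /ucycle rot_cycle rot_uniq.
    rewrite -(size_rot i) def_c; case: c' subc {def_c} => [|x [|y p]] //= subc.
    case/andP=> /= /andP[evx].
    rewrite -[_ && path _ _ _]/(path e x (rcons (y :: p) v)).
    rewrite rcons_path -[last x _]/(last y p).
    case/andP=> pth elv /andP[vNp /andP[xNp _]].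
    have inA z : z \in x :: y :: p -> (z \in A) && (z != v).
      move=> zp; rewrite subc ?[z \in v :: _]inE ?zp ?orbT //=.
      by apply: contraNneq vNp => <-.
    have xC : x \in C :\ v.
      have /andP[xA xv] := inA x (mem_head _ _).
      by rewrite !inE xv (closed v).
    have pthC : path (induced (C :\ v)) x (y :: p).
      apply: (path_closed closedC xC) pth; apply/allP=> z zp.
      by apply: inA; rewrite inE zp orbT.
    have [_ subp] := path_induced pthC.
    suff xl : x = last y p by rewrite xl mem_last in xNp.
    apply: uniq1.
    - by rewrite inE xC.
    - by rewrite inE subp ?mem_last // e_sym.
    by apply/connectP; exists (y :: p).
  case: c => [//|x c] in vNc ucyc sub *.
  have inA : all [pred b | (b \in A) && (b != v)] (x :: c).
    apply/allP=> z zc /=; rewrite sub //.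
    by apply: contraNneq vNc => <-.
  have /andP[/= xA xv] := allP inA x (mem_head _ _).
  have pth : path e x c.
    by case/andP: ucyc => /=; rewrite rcons_path => /andP[].
  have [xC|xNC] := boolP (x \in C).
    have xC' : x \in C :\ v by rewrite !inE xv.
    have /andP[_ inA'] := inA.
    have [_ subC] := path_induced (path_closed closedC xC' inA' pth).
    by apply: (acyc1 (x :: c)) => // z; rewrite inE => /predU1P[->|/subC].
  have xD : x \in A :\: C by rewrite inE xNC.
  have inA' : all [in A] c.
    by apply/allP=> z zc; apply: sub; rewrite inE zc orbT.
  have [_ subD] := path_induced (path_closed closedD xD inA' pth).
  by apply: (acyc2 (x :: c)) => // z; rewrite inE => /predU1P[->|/subD].
- move=> u uA; have [->|uv] := eqVneq u v; first by exists v.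
  have [uC|uC] := boolP (u \in C).
    have /ex1[r rS cur] : u \in C :\ v by rewrite !inE uv.
    have sCA : C :\ v \subset A by apply: subset_trans CA; apply: subsetDl.
    exists v => //.
    apply: connect_trans (connect_induced_sub sCA cur) _.
    apply: connect1; move: rS; rewrite inE => /andP[rC evr].
    by rewrite /induced (subsetP sCA) // (subsetP CA) // e_sym.
  have /ex2[r /setD1P[_ rS] cur] : u \in A :\: C by rewrite inE uC.
  by exists r => //; apply: connect_induced_sub cur; apply: subsetDl.
move=> r s rS sS crs.
have [rC|rNC] := boolP (r \in C).
  have [sC _] := connect_closed closed rC crs.
  by rewrite (uniqC r) // (uniqC s).
have rv : r \in S :\ v by rewrite !inE rS andbT; apply: contraNneq rNC => ->.
have rD := S2 _ rv.
have [sD crsD] := connect_closed closedD rD crs.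
apply: uniq2 crsD => //; rewrite !inE sS andbT.
by apply: contraTneq sD => ->; rewrite inE vC.
Qed.

End Forests.

(** * Binary trees as codes of rooted forests *)

Section Trees.
Variable n : nat.
Implicit Types (B l r : bintree 'I_n) (u v x y : 'I_n) (A C S : {set 'I_n}).

Lemma blabels_node l v c r :
  blabels (Node l v c r) = v :: blabels l ++ blabels r.
Proof. by rewrite /blabels /= map_cat. Qed.

Lemma bmin_leaf : @bmin n Leaf = n.
Proof. by rewrite /bmin big_nil. Qed.

Lemma bmin_seq_le (s : seq 'I_n) : \big[minn/n]_(u <- s) (u : nat) <= n.
Proof. by elim/big_ind: _ => // [a b|u _]; [lia|apply: ltnW]. Qed.

Lemma bmin_node l v c r :
  bmin (Node l v c r) = minn v (minn (bmin l) (bmin r)).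
Proof.
rewrite /bmin blabels_node big_cons; congr minn.
elim: (blabels l) => [|u s IHs] /=.
  by rewrite big_nil; have := bmin_seq_le (blabels r); lia.
by rewrite !big_cons IHs minnA.
Qed.

Lemma bmin_gt B k : k < n ->
  (k < bmin B) = all (fun u : 'I_n => k < u) (blabels B).
Proof.
move=> kn; elim: B => [|l IHl v c r IHr]; first by rewrite bmin_leaf.
by rewrite bmin_node blabels_node /= all_cat -IHl -IHr; lia.
Qed.

Lemma bmin_ge B k : k <= n ->
  (k <= bmin B) = all (fun u : 'I_n => k <= u) (blabels B).
Proof.
move=> kn; elim: B => [|l IHl v c r IHr]; first by rewrite bmin_leaf.
by rewrite bmin_node blabels_node /= all_cat -IHl -IHr; lia.
Qed.

Lemma bmin_le B u : u \in blabels B -> bmin B <= u.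
Proof.
elim: B => [//|l IHl v c r IHr]; rewrite blabels_node bmin_node inE mem_cat.
by case/or3P=> [/eqP->|/IHl|/IHr]; lia.
Qed.

Lemma bmin_mem B : bmin B < n ->
  exists2 u : 'I_n, u \in blabels B & u = bmin B :> nat.
Proof.
elim: B => [|l IHl v c r IHr]; first by rewrite bmin_leaf ltnn.
rewrite blabels_node bmin_node => lt.
have [le1|gt1] := leqP v (minn (bmin l) (bmin r)).
  by exists v; [apply: mem_head|rewrite /=; lia].
have [le2|gt2] := leqP (bmin l) (bmin r).
  have [|u ul minu] := IHl; first by lia.
  by exists u; [rewrite inE mem_cat ul orbT|lia].
have [|u ur minu] := IHr; first by lia.
by exists u; [rewrite inE mem_cat ur !orbT|lia].
Qed.

Lemma eq_bmin B B' : blabels B =i blabels B' -> bmin B = bmin B'.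
Proof.
move=> eqB; apply/eqP; rewrite eqn_leq !bmin_ge ?bmin_seq_le //.
by rewrite (eq_all_r eqB) -(eq_all_r eqB); apply/andP; split;
  apply/allP=> u uB; apply: bmin_le; rewrite ?eqB // -eqB.
Qed.

(** The roots of the forest coded by [B] under the left-child/right-sibling
    correspondence: the root of [B] and its successive right children. *)
Fixpoint broots B : seq 'I_n :=
  if B is Node _ v _ r then v :: broots r else [::].

(** The pairs (parent, child) of the forest coded by [B]: the children of [v] are
    the roots of the forest coded by the left subtree of [v]. *)
Fixpoint bedges B : seq ('I_n * 'I_n) :=
  if B is Node l v _ r then
    [seq (v, x) | x <- broots l] ++ bedges l ++ bedges r
  else [::].

Definition badj B : rel 'I_n :=
  fun x y => ((x, y) \in bedges B) || ((y, x) \in bedges B).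

Lemma broots_labels B : {subset broots B <= blabels B}.
Proof.
elim: B => [//|l _ v c r IHr] x; rewrite blabels_node !inE mem_cat.
by move=> /predU1P[->|/IHr->]; rewrite ?eqxx ?orbT.
Qed.

Lemma bedges_labels B x y :
  (x, y) \in bedges B -> x \in blabels B /\ y \in blabels B.
Proof.
elim: B => [//|l IHl v c r IHr] /=; rewrite blabels_node !mem_cat.
case/or3P=> [/mapP[z /broots_labels zl [-> ->]]|/IHl[]|/IHr[]];
  rewrite !inE !mem_cat; first by rewrite eqxx zl orbT.
all: by move=> -> ->; rewrite !orbT.
Qed.

Lemma badj_sym B : symmetric (badj B).
Proof. by move=> x y; rewrite /badj orbC. Qed.

Lemma badj_labels B x y : badj B x y -> x \in blabels B /\ y \in blabels B.
Proof. by case/orP=> /bedges_labels[]. Qed.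

Lemma badj_node l v c r x y : badj (Node l v c r) x y =
  [|| (x == v) && (y \in broots l), (y == v) && (x \in broots l),
      badj l x y | badj r x y].
Proof.
have star a b : ((a, b) \in [seq (v, z) | z <- broots l]) =
    (a == v) && (b \in broots l).
  apply/mapP/andP=> [[z zl [-> ->]]|[/eqP-> bl]]; first by rewrite eqxx.
  by exists b.
rewrite /badj /= !mem_cat !star -!orbA.
by do !bool_congr.
Qed.

Lemma badj_irr B : uniq (blabels B) -> irreflexive (badj B).
Proof.
elim: B => [//|l IHl v c r IHr]; rewrite blabels_node /= mem_cat cat_uniq.
case/andP=> /norP[vl vr] /and3P[/IHl il _ /IHr ir] x.
rewrite badj_node il ir !orbF orbb; apply/negP=> /andP[/eqP-> /broots_labels].
exact/negP.
Qed.

(** [B] codes the forest induced by [e] on [A] with roots [S]. *)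
Record realizes B (e : rel 'I_n) A S : Prop := Realizes {
  realizes_uniq : uniq (blabels B);
  realizes_labels : blabels B =i A;
  realizes_adj : {in A &, badj B =2 e};
  realizes_roots : broots B =i S
}.

(** This is the plane-tree condition that siblings come in increasing order of
    the minima of their subtrees: the descendants of [v] in the forest coded by
    [B] are [v] and the labels of [l], those of its later siblings are the labels
    of [r]. For distinct labels it also says that no vertex is right improper:
    if [bmin r] exceeds [minn v (bmin l)], then [v] can only be improper because
    of a smaller label in [l]. *)
Fixpoint ordered B : bool :=
  if B is Node l v _ r then
    [&& minn v (bmin l) < bmin r, ordered l & ordered r]
  else true.

Section Realizes.
Variable e : rel 'I_n.
Hypotheses (e_sym : symmetric e) (e_irr : irreflexive e).

(** Cutting a binary tree at its root [v] cuts the coded forest in the same way: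
    the left subtree codes the forest of the proper descendants of [v], the right
    subtree codes what remains after the component of [v] is removed. *)
Lemma realizes_nodeE l v c r A S : realizes (Node l v c r) e A S ->
  let C := v |: [set u in blabels l] in
  [/\ root_component e A S v C, realizes l e (C :\ v) (child_roots e v C)
    & realizes r e (A :\: C) (S :\ v)].
Proof.
case; rewrite blabels_node /= mem_cat cat_uniq.
move=> /andP[/norP[vl vr] /and3P[ul /hasPn disj ur]] labE adjE rootE.
set C := _ |: _.
have CE u : (u \in C) = (u == v) || (u \in blabels l) by rewrite !inE.
have C'E : blabels l =i C :\ v.
  move=> u; rewrite in_setD1 CE; case: eqVneq => //= ->; exact: negbTE.
have vA : v \in A by rewrite -labE mem_head.
have AE u : (u \in A) = [|| u == v, u \in blabels l | u \in blabels r].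
  by rewrite -labE inE mem_cat.
have DE : blabels r =i A :\: C.
  move=> u; rewrite in_setD CE AE; case: eqVneq => [->|_] /=.
    exact: negbTE.
  by case: (boolP (u \in blabels l)) => //= ul'; apply: contraTF ul' => /disj.
have rootsE : broots r =i S :\ v.
  move=> u; rewrite in_setD1 -rootE inE; case: eqVneq => //= ->.
  by apply: contraNF vr => /broots_labels.
have badjF x y : x \in blabels l -> badj r x y = false.
  by move=> xl; apply/negP=> /badj_labels[/disj/=]; rewrite xl.
have badjlF x y : x \in blabels r -> badj l x y = false.
  by move=> xr; apply/negP=> /badj_labels[/(negP (disj _ xr))].
have badjlvF y : badj l v y = false.
  by apply/negP=> /badj_labels[/(negP vl)].
have badjrvF y : badj r v y = false.
  by apply/negP=> /badj_labels[/(negP vr)].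
have vrl : v \in broots l = false by apply: contraNF vl => /broots_labels.
split.
- split.
  + by rewrite -rootE mem_head.
  + by rewrite CE eqxx.
  + by apply/subsetP=> u; rewrite CE AE orbA => ->.
  + move=> s; rewrite -rootE inE CE => /predU1P[//|/broots_labels/disj/=].
    by move=> /negPf->; rewrite orbF => /eqP.
  move=> x y xC yA; have xA : x \in A by move: xC; rewrite CE AE orbA => ->.
  rewrite -adjE // badj_node CE.
  move: xC; rewrite CE => /predU1P[->|xl]; last first.
    rewrite (badjF x) // orbF => /or3P[/andP[_]|/andP[->]//|/badj_labels[_ ->]].
      by move/broots_labels->; rewrite orbT.
    by rewrite orbT.
  rewrite eqxx vrl badjlvF badjrvF andbF !orbF => /broots_labels->.
  exact: orbT.
- split=> //; first move=> x y.
    rewrite !in_setD1 !CE => /andP[xv /= xl] /andP[yv /= yl].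
    rewrite (negPf xv) (negPf yv) /= in xl yl.
    rewrite -adjE ?AE ?xl ?yl ?orbT // badj_node (negPf xv) (negPf yv) /=.
    by rewrite (badjF x) // orbF.
  move=> u; rewrite inE -C'E; case: (boolP (u \in blabels l)) => ul' /=.
    have uv : u != v by apply: contraTneq ul' => ->.
    by rewrite -adjE ?AE ?ul' ?orbT ?eqxx // badj_node eqxx (negPf uv)
         badjlvF badjrvF !orbF.
  by apply: contraNF ul' => /broots_labels.
split=> // x y; rewrite -!DE => xr yr.
have xv : x != v by apply: contraTneq xr => ->.
have yv : y != v by apply: contraTneq yr => ->.
rewrite -adjE ?AE ?xr ?yr ?orbT // badj_node (negPf xv) (negPf yv) /=.
by rewrite badjlF.
Qed.

Lemma realizes_nodeI l v c r A S C : root_component e A S v C ->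
    realizes l e (C :\ v) (child_roots e v C) ->
    realizes r e (A :\: C) (S :\ v) ->
  realizes (Node l v c r) e A S.
Proof.
move=> comp [ul labl adjl rootl] [ur labr adjr rootr].
have [vS vC /subsetP CA uniqC closed] := comp.
have closedD := component_compl e_sym comp.
have vl : v \notin blabels l by rewrite labl !inE eqxx.
have vr : v \notin blabels r by rewrite labr inE vC.
have AE u : (u \in A) = [|| u == v, u \in blabels l | u \in blabels r].
  rewrite labl labr !inE; case: eqVneq => [->|_] /=; first exact: CA.
  by case: (boolP (u \in C)) => //= /CA.
have disj u : u \in blabels r -> u \notin blabels l.
  by rewrite labl labr !inE negb_and => /andP[->]; rewrite orbT.
have lC u : u \in blabels l -> u \in C by rewrite labl => /setD1P[].
have rC u : u \in blabels r -> u \notin C by rewrite labr => /setDP[].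
have lA u : u \in blabels l -> u \in A by move/lC/CA.
have rA u : u \in blabels r -> u \in A by rewrite labr => /setDP[].
split.
- rewrite blabels_node /= mem_cat cat_uniq negb_or vl vr ul ur /= andbT.
  exact/hasPn.
- by move=> u; rewrite blabels_node inE mem_cat AE.
- have cross x y : x \in C -> y \in blabels r -> e x y = false.
    move=> xC yr; apply/negP=> /(closed x y xC (rA _ yr)).
    exact/negP/rC.
  have badjlF x y : x \notin blabels l -> badj l x y = false.
    by move=> xl; apply/negP=> /badj_labels[/(negP xl)].
  have badjrF x y : x \notin blabels r -> badj r x y = false.
    by move=> xl; apply/negP=> /badj_labels[/(negP xl)].
  have rootF x : x \notin blabels l -> (x \in broots l) = false.
    by move=> xl; apply: contraNF xl => /broots_labels.
  have rootlE y : y \in blabels l -> (y \in broots l) = e v y.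
    by move=> yl; rewrite rootl inE -labl yl.
  have half x y : x \in A -> y \in A ->
      (y \in v :: blabels l ++ blabels r) ->
      [|| x == v, (x \in blabels l) && (y != v) |
          (x \in blabels r) && (y \in blabels r)] ->
      badj (Node l v c r) x y = e x y.
    move=> xA yA ycase xcase; rewrite badj_node.
    case/or3P: xcase => [/eqP->|/andP[xl yv]|/andP[xr yr]].
    + rewrite eqxx (rootF v) // andbF (badjlF v) // (badjrF v) // !orbF /=.
      move: ycase; rewrite inE mem_cat => /or3P[/eqP->|yl|yr].
      * by rewrite e_irr rootF.
      * exact: rootlE.
      by rewrite rootF ?disj // cross.
    + have xr : x \notin blabels r by apply: contraL xl => /disj.
      have xv : x != v by apply: contraTneq xl => ->.
      rewrite (negPf xv) (negPf yv) (badjrF x) // orbF /=.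
      move: ycase; rewrite inE mem_cat (negPf yv) /= => /orP[yl|yr].
        by rewrite adjl // -labl.
      by rewrite cross ?lC // badj_sym badjlF // disj.
    have xv : x != v by apply: contraTneq xr => ->.
    have yv : y != v by apply: contraTneq yr => ->.
    by rewrite (negPf xv) (negPf yv) /= badjlF ?disj // adjr // -labr.
  (* [half] covers each pair of vertices in at least one of its two orders. *)
  move=> x y xA yA.
  have inl u : u \in A -> u \in v :: blabels l ++ blabels r.
    by rewrite inE mem_cat AE.
  case: (boolP [|| x == v, (x \in blabels l) && (y != v) |
               (x \in blabels r) && (y \in blabels r)]) => [h|h].
    by apply: half => //; apply: inl.
  rewrite badj_sym e_sym; apply: half => //; first exact: inl.
  move: (xA) (yA) h; rewrite !AE.
  case: eqVneq => //= _; case: eqVneq => //= _.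
  by case: (x \in blabels l); case: (y \in blabels l) => //=;
     rewrite ?andbT ?andbF => -> //= ->.
move=> u; rewrite inE rootr !inE.
by case: eqVneq => // ->; rewrite vS.
Qed.

Lemma realizes_forest B A S : realizes B e A S -> rooted_forest e A S.
Proof.
elim: B A S => [|l IHl v c r IHr] A S.
  case=> _ labE _ rootE.
  have A0 u : u \in A = false by rewrite -labE.
  split.
  - by apply/subsetP=> u; rewrite -rootE.
  - by case=> [//|x c] _ /(_ x (mem_head _ _)); rewrite A0.
  - by move=> u; rewrite A0.
  by move=> s t; rewrite -rootE.
case/realizes_nodeE=> comp /IHl F1 /IHr F2.
exact: rooted_forest_join comp F1 F2.
Qed.

(** In an ordered code the root carries the component of the smallest label. So
    this component comes first, and its root can be read off from the graph. *)
Lemma ordered_min_root l v c r A S m :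
    realizes (Node l v c r) e A S -> ordered (Node l v c r) ->
    m \in A -> m = bmin (Node l v c r) :> nat ->
  connect (induced e A) m v.
Proof.
move=> rB oB mA minm.
have FA := realizes_forest rB; have [comp _ rr] := realizes_nodeE rB.
suff: m \in v |: [set u in blabels l].
  by rewrite (forest_component e_sym FA comp) inE => /andP[].
rewrite -[_ \in _]negbK; apply/negP=> mNC.
have /bmin_le : m \in blabels r.
  by rewrite (realizes_labels rr) in_setD mNC.
by case/and3P: oB; rewrite minm bmin_node; lia.
Qed.

(** By [ordered_min_root] both trees have the same root [v], the root of the
    component of the smallest label. Its component is then determined as well,
    hence so are the two forests coded by the left and right subtrees. *)
Lemma realizes_unique (col : 'I_n -> bool) B B' A S :
    realizes B e A S -> realizes B' e A S ->
    ordered B -> ordered B' ->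
    (forall x c, (x, c) \in bnodes B -> c = col x) ->
    (forall x c, (x, c) \in bnodes B' -> c = col x) ->
  B = B'.
Proof.
elim: B B' A S => [|l IHl v c r IHr] [|l' v' c' r'] A S rB rB' oB oB' cB cB' //.
- have := realizes_labels rB' v'; rewrite -(realizes_labels rB).
  by rewrite blabels_node mem_head.
- have := realizes_labels rB v; rewrite -(realizes_labels rB').
  by rewrite blabels_node mem_head.
have eqmin : bmin (Node l v c r) = bmin (Node l' v' c' r').
  by apply: eq_bmin => u; rewrite (realizes_labels rB) (realizes_labels rB').
have [|m mB minB] := @bmin_mem (Node l v c r).
  by rewrite bmin_node; have := ltn_ord v; lia.
have mA : m \in A by rewrite -(realizes_labels rB).
have FA := realizes_forest rB.
have mv := ordered_min_root rB oB mA minB.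
have mv' := ordered_min_root rB' oB' mA (etrans minB eqmin).
have [comp rl rr] := realizes_nodeE rB.
have [comp' rl' rr'] := realizes_nodeE rB'.
have vv' : v = v'.
  apply: (forest_root_uniq FA) (comp_root comp) (comp_root comp') _.
  apply: connect_trans mv'.
  by rewrite (sym_connect_sym (induced_sym e_sym A)).
subst v'.
have CC' := etrans (forest_component e_sym FA comp)
  (esym (forest_component e_sym FA comp')).
rewrite -CC' in rl' rr'.
case/and3P: oB => _ ol or; case/and3P: oB' => _ ol' or'.
congr Node.
- apply: (IHl _ _ _ rl rl' ol ol') => x d xd.
    by apply: cB; rewrite inE mem_cat xd orbT.
  by apply: cB'; rewrite inE mem_cat xd orbT.
- by rewrite (cB v c (mem_head _ _)) (cB' v c' (mem_head _ _)).
apply: (IHr _ _ _ rr rr' or or') => x d xd.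
  by apply: cB; rewrite inE mem_cat xd !orbT.
by apply: cB'; rewrite inE mem_cat xd !orbT.
Qed.

(** The choice forced by [ordered_min_root] also works: put at the root of [B] the
    root of the component of the smallest label, then recurse. *)
Lemma realizes_exists (col : 'I_n -> bool) A S : rooted_forest e A S ->
  exists B, [/\ realizes B e A S, ordered B
              & forall x c, (x, c) \in bnodes B -> c = col x].
Proof.
have [k] := ubnP #|A|; elim: k A S => // k IHk A S ltAk FA.
have [A0|[a aA]] := set_0Vmem A; last first.
  have [m mA mmin] : exists2 m, m \in A & forall u : 'I_n, u \in A -> m <= u.
    by case: (arg_minnP (@nat_of_ord n) aA) => m mA mmin; exists m.
  have [v vS mv] := forest_root_ex FA mA.
  have comp := root_component_ex e_sym FA vS.
  set C := [set u in A | _] in comp.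
  have mC : m \in C by rewrite inE mA.
  have vC := comp_mem comp; have CA := subset_leq_card (comp_sub comp).
  have F1 := rooted_forest_children e_sym comp FA.
  have F2 := rooted_forest_tail e_sym comp FA.
  have [|l [rl ol cl]] := IHk _ _ _ F1.
    by rewrite (cardsD1 v C) vC add1n in CA; apply: leq_trans CA _.
  have [|r [rr or cr]] := IHk _ _ _ F2.
    rewrite -ltnS; apply: leq_trans ltAk; rewrite ltnS.
    rewrite -[leqRHS](cardsID C A) (setIidPr (comp_sub comp)).
    by rewrite (cardsD1 v C) vC -addnA add1n ltnS leq_addl.
  exists (Node l v (col v) r); split.
  - exact: realizes_nodeI comp rl rr.
  - rewrite /= ol or !andbT.
    have le1 : minn v (bmin l) <= m.
      have [<-|mNv] := eqVneq m v; first by lia.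
      have /bmin_le : m \in blabels l.
        by rewrite (realizes_labels rl) in_setD1 mNv.
      by lia.
    apply: leq_ltn_trans le1 _; rewrite bmin_gt //; apply/allP=> u.
    rewrite (realizes_labels rr) => /setDP[uA uNC].
    rewrite ltn_neqAle mmin // andbT.
    by apply: contra uNC => /eqP/val_inj <-.
  move=> x c /=; rewrite inE mem_cat => /or3P[/eqP[-> ->]//|/cl|/cr] //.
subst A; exists Leaf; split=> //; split=> //.
- by move=> u; rewrite !inE.
- by move=> u v; rewrite inE.
by have := forest_roots FA; rewrite subset0 => /eqP-> u; rewrite inE.
Qed.

End Realizes.
End Trees.

(** * Flips *)

Section Flips.
Variable n : nat.
Implicit Types (B l r : bintree 'I_n) (u v x y : 'I_n) (P : pred 'I_n).

(** Simultaneous flips at the subtrees satisfying [p], tested before anything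
    below is flipped. A node sees its whole subtree, so that one recursion covers
    flipping a given set of vertices, [flip_right_improper] and its inverse. *)
Fixpoint flip_where (p : pred (bintree 'I_n)) B : bintree 'I_n :=
  if B is Node l v c r then
    if p B then Node (flip_where p r) v (~~ c) (flip_where p l)
    else Node (flip_where p l) v c (flip_where p r)
  else Leaf.

Lemma blabels_flip_where p B : perm_eq (blabels (flip_where p B)) (blabels B).
Proof.
elim: B => // l IHl v c r IHr /=.
case: ifP => _; rewrite !blabels_node perm_cons; last exact: perm_cat.
by rewrite perm_catC perm_cat.
Qed.

Lemma bmin_flip_where p B : bmin (flip_where p B) = bmin B.
Proof. exact/eq_bmin/perm_mem/blabels_flip_where. Qed.

Definition root_in P B := if B is Node _ v _ _ then P v else false.

Lemma eq_flip_where_root P P' B : {in blabels B, P =1 P'} ->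
  flip_where (root_in P) B = flip_where (root_in P') B.
Proof.
elim: B => //= l IHl v c r IHr; rewrite blabels_node => eqP.
rewrite eqP ?mem_head // IHl ?IHr // => u uB; apply: eqP;
  by rewrite inE mem_cat uB ?orbT.
Qed.

Lemma flip_notin v B : v \notin blabels B -> flip v B = B.
Proof.
elim: B => //= l IHl u c r IHr; rewrite blabels_node inE mem_cat !negb_or.
by case/and3P=> vu /IHl-> /IHr->; rewrite eq_sym (negPf vu).
Qed.

Lemma foldr_flip_notin B s :
  {in s, forall v, v \notin blabels B} -> foldr (@flip n) B s = B.
Proof.
elim: s => //= v s IHs sB; rewrite IHs => [|u us].
  by rewrite flip_notin // sB // mem_head.
by rewrite sB // inE us orbT.
Qed.

Lemma foldr_flip_node l v c r s : v \notin s ->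
  foldr (@flip n) (Node l v c r) s =
  Node (foldr (@flip n) l s) v c (foldr (@flip n) r s).
Proof.
elim: s => //= u s IHs; rewrite inE negb_or => /andP[vu /IHs->] /=.
by rewrite (negPf vu).
Qed.

(** Labels being distinct, a flip at a vertex of one subtree leaves the other
    subtree and the root alone. *)
Lemma foldr_flip P B : uniq (blabels B) ->
  foldr (@flip n) B [seq v <- blabels B | P v] = flip_where (root_in P) B.
Proof.
elim: B => // l IHl v c r IHr; rewrite blabels_node /= mem_cat cat_uniq.
case/andP=> /norP[vl vr] /and3P[/IHl{}IHl /hasPn disj /IHr{}IHr].
have sub s : {subset [seq u <- s | P u] <= s}.
  by move=> u; rewrite mem_filter => /andP[].
have key : foldr (@flip n) (Node l v c r) [seq u <- blabels l ++ blabels r | P u]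
    = Node (flip_where (root_in P) l) v c (flip_where (root_in P) r).
  rewrite filter_cat foldr_cat foldr_flip_node; last by apply: contra vr => /sub.
  rewrite IHr [foldr _ l _]foldr_flip_notin => [|u /sub/disj //].
  rewrite foldr_flip_node; last by apply: contra vl => /sub.
  rewrite IHl foldr_flip_notin // => u /sub ul.
  by rewrite (perm_mem (blabels_flip_where _ _)); apply: contraL ul => /disj.
by case: ifP => Pv /=; rewrite key //= eqxx.
Qed.

Lemma bsub_notin B v : v \notin blabels B -> bsub B v = Leaf.
Proof.
elim: B => //= l IHl u c r IHr; rewrite blabels_node inE mem_cat !negb_or.
by case/and3P=> vu vl /IHr->; rewrite eq_sym (negPf vu) (negPf vl).
Qed.

Lemma bsub_left l v c r u : v \notin blabels l -> u \in blabels l ->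
  bsub (Node l v c r) u = bsub l u.
Proof. by move=> vl ul /=; rewrite ul; case: eqVneq vl => // ->; rewrite ul. Qed.

Lemma bsub_right l v c r u : v \notin blabels r -> u \notin blabels l ->
  u \in blabels r -> bsub (Node l v c r) u = bsub r u.
Proof.
by move=> vr /negPf ul ur /=; rewrite ul; case: eqVneq vr => // ->; rewrite ur.
Qed.

Lemma proper_vertex_root l v c r :
  proper_vertex (Node l v c r) v = (v <= minn (bmin l) (bmin r)).
Proof.
rewrite /proper_vertex /= eqxx -bmin_ge; last exact/ltnW.
by rewrite bmin_node; lia.
Qed.

Lemma right_improper_root l v c r :
  right_improper (Node l v c r) v = (bmin r < minn v (bmin l)).
Proof.
by rewrite /right_improper proper_vertex_root /bleft /bright /= eqxx; lia.
Qed.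

(** The root is right improper, see [right_improper_root]. *)
Definition misordered B :=
  if B is Node l v _ r then bmin r < minn v (bmin l) else false.

Lemma flip_right_improperE B : uniq (blabels B) ->
  flip_right_improper B = flip_where misordered B.
Proof.
move=> uB; rewrite /flip_right_improper foldr_flip //.
elim: B uB => // l IHl v c r IHr; rewrite blabels_node /= mem_cat cat_uniq.
case/andP=> /norP[vl vr] /and3P[/IHl<- /hasPn disj /IHr<-].
rewrite right_improper_root.
have -> : flip_where (root_in (right_improper (Node l v c r))) l =
    flip_where (root_in (right_improper l)) l.
  apply: eq_flip_where_root => u ul.
  by rewrite /right_improper /proper_vertex /bleft /bright bsub_left.
suff -> : flip_where (root_in (right_improper (Node l v c r))) r =
    flip_where (root_in (right_improper r)) r.
  by [].
apply: eq_flip_where_root => u ur.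
by rewrite /right_improper /proper_vertex /bleft /bright bsub_right //; apply: disj.
Qed.

(** The recursive form of the color condition defining [Dbi], see
    [improper_blackP]. *)
Fixpoint improper_black B : bool :=
  if B is Node l v c r then
    [&& (v <= minn (bmin l) (bmin r)) || c, improper_black l & improper_black r]
  else true.

Lemma bnodes_labels B (x : 'I_n * bool) : x \in bnodes B -> x.1 \in blabels B.
Proof. exact: map_f. Qed.

Lemma improper_blackP B : uniq (blabels B) ->
  (forall v, ~~ proper_vertex B v -> (v, black) \in bnodes B) <->
  improper_black B.
Proof.
elim: B => [|l IHl v c r IHr]; first by split.
rewrite blabels_node /= mem_cat cat_uniq.
case/andP=> /norP[vl vr] /and3P[/IHl{}IHl /hasPn disj /IHr{}IHr].
have nodes_root d : (v, d) \in bnodes (Node l v c r) -> d = c.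
  rewrite /= inE mem_cat => /or3P[/eqP[->] //|/bnodes_labels|/bnodes_labels] /=;
    by rewrite (negPf vl, negPf vr).
split=> [H|/and3P[bv /IHl Hl /IHr Hr] u].
  apply/and3P; split.
  - rewrite -(proper_vertex_root l v c r); case: (boolP (proper_vertex _ _)) => //=.
    by move/H/nodes_root <-.
  - apply/IHl=> u imp.
    have ul : u \in blabels l.
      by apply: contraR imp => /bsub_notin; rewrite /proper_vertex => ->.
    have uv : u != v by apply: contraTneq ul => ->.
    have := H u; rewrite /proper_vertex bsub_left // => /(_ imp).
    rewrite inE mem_cat => /or3P[/eqP[/eqP]|//|/bnodes_labels/disj/=].
      by rewrite (negPf uv).
    by rewrite ul.
  apply/IHr=> u imp.
  have ur : u \in blabels r.
    by apply: contraR imp => /bsub_notin; rewrite /proper_vertex => ->.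
  have uv : u != v by apply: contraTneq ur => ->.
  have := H u; rewrite /proper_vertex bsub_right ?disj // => /(_ imp).
  rewrite inE mem_cat => /or3P[/eqP[/eqP]|/bnodes_labels|//].
    by rewrite (negPf uv).
  by rewrite (negPf (disj _ ur)).
have [->|uv] := eqVneq u v.
  rewrite proper_vertex_root => nle; move: bv; rewrite (negPf nle) /= => ->.
  exact: mem_head.
rewrite -[(_, _) \in _]/((u, black) \in (v, c) :: bnodes l ++ bnodes r) => imp.
have := imp; rewrite /proper_vertex /= eq_sym (negPf uv) inE mem_cat.
by case: ifP => [_ /Hl->|_ /Hr->]; rewrite ?orbT.
Qed.

(** Improper vertices are black before the flips, so the flipped ones are exactly
    the improper vertices that are white afterwards. *)
Definition white_improper B :=
  if B is Node l v c r then ~~ c && (minn (bmin l) (bmin r) < v) else false.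

Lemma flip_misorderedK B : improper_black B ->
  flip_where white_improper (flip_where misordered B) = B.
Proof.
elim: B => //= l IHl v c r IHr /and3P[bv /IHl{}IHl /IHr{}IHr].
case: ifP => /= lt; rewrite !bmin_flip_where IHl IHr.
  have -> : c = true by lia.
  by rewrite ifT //=; lia.
by rewrite ifF //; lia.
Qed.

Lemma unflipK B : ordered B ->
  flip_where misordered (flip_where white_improper B) = B.
Proof.
elim: B => //= l IHl v c r IHr /and3P[lt /IHl{}IHl /IHr{}IHr].
case: ifP => /= cond; rewrite !bmin_flip_where IHl IHr.
  by rewrite ifT ?negbK //; lia.
by rewrite ifF //; lia.
Qed.

Lemma unflip_improper_black B : improper_black (flip_where white_improper B).
Proof.
elim: B => //= l IHl v c r IHr.
by case: ifP => /= cond; rewrite !bmin_flip_where IHl IHr; lia.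
Qed.

(** After the flips the child subtree with the smaller minimum is on the left below
    each improper vertex. The inequality required by [ordered] is strict because
    labels are distinct; [n] stands for the minimum of an empty subtree and
    exceeds all labels. *)
Lemma flip_misordered_ordered B :
  uniq (blabels B) -> ordered (flip_where misordered B).
Proof.
elim: B => // l IHl v c r IHr; rewrite blabels_node /= mem_cat cat_uniq.
case/andP=> /norP[vl vr] /and3P[/IHl{}IHl /hasPn disj /IHr{}IHr].
case: ifP => lt /=; rewrite !bmin_flip_where IHl IHr !andbT.
  by lia.
have ltv := ltn_ord v.
have [|ler] := ltnP (bmin r) n; last by lia.
case/bmin_mem=> m mr minm.
have mv : m != v :> nat by apply: contraNneq vr => /val_inj <-.
have lm : m != bmin l :> nat.
  apply/eqP=> eqm; have /bmin_mem[m' ml' minm'] : bmin l < n by rewrite -eqm.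
  have /val_inj mm' : val m' = val m by rewrite /= minm' eqm.
  by move: (disj _ mr); rewrite -mm' /= ml'.
by lia.
Qed.

End Flips.

(** * The graph of a binary tree *)

Section Graphs.
Variable n : nat.
Implicit Types (B l r : bintree 'I_n) (u v x y : 'I_n).
Local Notation widen := (widen_ord (leqnSn n)).

Lemma proots_psiblings B :
  [seq proot t | t <- psiblings B] = map widen (broots B).
Proof. by elim: B => //= l _ v c r ->. Qed.

Lemma pnodes_psiblings B :
  flatten [seq pnodes t | t <- psiblings B]
    = [seq (widen z.1, z.2) | z <- bnodes B].
Proof. by elim: B => //= l IHl v c r IHr; rewrite IHl IHr map_cat. Qed.

Lemma pedges_psiblings B :
  flatten [seq pedges t | t <- psiblings B]
    = [seq (widen z.1, widen z.2) | z <- bedges B].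
Proof.
elim: B => //= l IHl v c r IHr; rewrite IHl IHr !map_cat -!map_comp -catA.
congr (_ ++ _ ++ _).
have := congr1 (map (pair (widen v))) (proots_psiblings l).
by rewrite -!map_comp.
Qed.

Lemma widen_inj : injective widen.
Proof. by move=> x y /(congr1 val) /= /val_inj. Qed.

Lemma widen_neq_max x : (ord_max == widen x) = false.
Proof. by apply/eqP=> /(congr1 val) /= eqn; have := ltn_ord x; rewrite -eqn ltnn. Qed.

Lemma set2_eq (V : finType) (a b c d : V) : [set a; b] = [set c; d] ->
  (a = c /\ b = d) \/ (a = d /\ b = c).
Proof.
move=> E.
have : a \in [set c; d] by rewrite -E set21.
have : b \in [set c; d] by rewrite -E set22.
have : c \in [set a; b] by rewrite E set21.
have : d \in [set a; b] by rewrite E set22.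
rewrite !inE; do 4! case/orP=> /eqP ?; subst; tauto.
Qed.

Lemma edges_unplaneE (V : finType) (Q : ptree V) a b :
  ([set a; b] \in edges (unplane Q)) =
  ((a, b) \in pedges Q) || ((b, a) \in pedges Q).
Proof.
apply/imsetP/orP=> [[[c d] cd /set2_eq[[-> ->]|[-> ->]]]|]; first by left.
  by right.
by case=> h; [exists (a, b)|exists (b, a)] => //=; rewrite setUC.
Qed.

Lemma pedges_Phi B : pedges (Phi B) =
  [seq (ord_max, widen x) | x <- broots B]
    ++ [seq (widen z.1, widen z.2) | z <- bedges B].
Proof.
rewrite /= pedges_psiblings; congr (_ ++ _).
have := congr1 (map (pair (@ord_max n))) (proots_psiblings B).
by rewrite -!map_comp.
Qed.

Lemma pedges_Phi_widen B x y :
  ((widen x, widen y) \in pedges (Phi B)) = ((x, y) \in bedges B).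
Proof.
rewrite pedges_Phi mem_cat.
have inj : injective (fun z : 'I_n * 'I_n => (widen z.1, widen z.2)).
  by move=> [a b] [c d] [/val_inj -> /val_inj ->].
rewrite -[(x, y) \in _](mem_map inj).
apply: orb_idl => /mapP[t _ /(congr1 fst)/eqP].
by rewrite /= eq_sym widen_neq_max.
Qed.

Lemma pedges_Phi_root B x :
  ((ord_max, widen x) \in pedges (Phi B)) = (x \in broots B).
Proof.
rewrite pedges_Phi mem_cat orbC orb_idl => [|/mapP[z _ /(congr1 fst)/eqP]]; last first.
  by rewrite /= widen_neq_max.
have inj : injective (fun z => (@ord_max n, widen z)) by move=> a b [/val_inj].
exact: (mem_map inj).
Qed.

Lemma pedges_Phi_child B x : ((widen x, ord_max) \in pedges (Phi B)) = false.
Proof.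
rewrite pedges_Phi mem_cat; apply/negP=> /orP[]/mapP[z _].
  by move/(congr1 fst)/eqP; rewrite /= eq_sym widen_neq_max.
by move/(congr1 snd)/eqP; rewrite /= widen_neq_max.
Qed.

Lemma adj_gamma B x y : adj (gamma (phi B)) x y = badj B x y.
Proof.
rewrite /adj inE imsetU !imset_set1 edges_unplaneE !pedges_Phi_widen.
by [].
Qed.

Lemma roots_gamma B : broots B =i roots (gamma (phi B)).
Proof.
move=> x; rewrite inE /adj edges_unplaneE pedges_Phi_root pedges_Phi_child.
by rewrite orbF.
Qed.

Lemma color_gamma B v : color (gamma (phi B)) v = ((v, black) \in bnodes B).
Proof.
rewrite !ffunE /= pnodes_psiblings inE xpair_eqE eq_sym widen_neq_max /=.
have inj : injective (fun z : 'I_n * bool => (widen z.1, z.2)).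
  by move=> [a b] [c d] [/val_inj -> ->].
exact: (mem_map inj (bnodes B) (v, black)).
Qed.

Lemma edges_gamma_card B e : uniq (blabels B) ->
  e \in edges (gamma (phi B)) -> #|e| = 2.
Proof.
move=> uB; rewrite inE => /imsetP[[a b] ab Ee].
have inW c : c \in [set a; b] -> exists2 x, x \in e & c = widen x.
  by rewrite -[[set a; b]]Ee => /imsetP.
have [x _ ax] := inW a (set21 _ _); have [y _ bY] := inW b (set22 _ _).
subst a b; move: ab; rewrite -[_ \in _]/(_ \in pedges (Phi B)) pedges_Phi_widen => xy.
have -> : e = [set x; y].
  by apply: (imset_inj widen_inj); rewrite Ee imsetU !imset_set1.
rewrite cards2; case: eqVneq xy => // -> yy.
by have := badj_irr uB y; rewrite /badj yy.
Qed.

(** Adjacency determines the edges only because they have two elements. *)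
Lemma rgraph_eq (V : finType) (F F' : rgraph V) :
    (forall e, e \in edges F -> #|e| = 2) ->
    (forall e, e \in edges F' -> #|e| = 2) ->
    adj F =2 adj F' -> roots F = roots F' -> color F =1 color F' ->
  F = F'.
Proof.
case: F F' => [E R c] [E' R' c'] /= E2 E'2 adjE -> /ffunP->.
congr RGraph; apply/setP=> e; apply/idP/idP=> eE.
  by have /eqP/cards2P[x [y [_ def_e]]] := E2 e eE; rewrite def_e in eE *;
    rewrite -[_ \in _]/(adj {| edges := E'; roots := R'; color := c' |} x y) -adjE.
by have /eqP/cards2P[x [y [_ def_e]]] := E'2 e eE; rewrite def_e in eE *;
    rewrite -[_ \in _]/(adj {| edges := E; roots := R; color := c |} x y) adjE.
Qed.

Lemma adj_sym (V : finType) (F : rgraph V) : symmetric (adj F).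
Proof. by move=> x y; rewrite /adj setUC. Qed.

Lemma induced_setT (V : finType) (e : rel V) : induced e [set: V] =2 e.
Proof. by move=> x y; rewrite /induced !inE. Qed.

Lemma is_forestP (V : finType) (F : rgraph V) :
  is_forest F <->
  (forall e, e \in edges F -> #|e| = 2) /\ rooted_forest (adj F) [set: V] (roots F).
Proof.
have conn := eq_connect (induced_setT (adj F)).
split=> [[E2 acyc root]|[E2 [_ acyc ex uniqS]]].
  split=> //; split.
  - exact: subsetT.
  - by move=> c cyc _; apply: acyc.
  - by move=> u _; have [r [[rS cur] _]] := root u; exists r; rewrite ?conn.
  move=> r s rS sS; rewrite conn => crs.
  have [t [_ tuniq]] := root r.
  by rewrite -(tuniq r) ?connect0 // -(tuniq s).
split=> // [c cyc|v]; first by apply: acyc => // x _; rewrite inE.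
have [r rS] := ex v (in_setT v); rewrite conn => cvr.
exists r; split=> // s [sS cvs]; apply: uniqS => //; rewrite conn.
by apply: connect_trans cvs; rewrite (sym_connect_sym (adj_sym F)).
Qed.

Lemma realizes_gamma B : Bbi B ->
  realizes B (adj (gamma (phi B))) [set: 'I_n] (roots (gamma (phi B))).
Proof.
move=> pB; split.
- by rewrite (perm_uniq pB) enum_uniq.
- by move=> u; rewrite (perm_mem pB) mem_enum !inE.
- by move=> x y _ _; rewrite adj_gamma.
exact: roots_gamma.
Qed.

Lemma adj_irr (V : finType) (F : rgraph V) :
  (forall e, e \in edges F -> #|e| = 2) -> irreflexive (adj F).
Proof. by move=> E2 x; apply/negP=> /E2; rewrite setUid cards1. Qed.

Lemma uniq_fst_inj (T U : eqType) (s : seq (T * U)) (x : T) (c d : U) :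
  uniq [seq z.1 | z <- s] -> (x, c) \in s -> (x, d) \in s -> c = d.
Proof.
elim: s => //= -[y b] s IHs /andP[/= yNs us].
have notin a : (y, a) \in s -> False by move/(map_f fst); exact/negP.
rewrite !inE => /predU1P[[-> ->]|xc] /predU1P[[]|xd] //.
- by move/notin: xd.
- by move=> xy; rewrite xy in xc; move/notin: xc.
exact: IHs.
Qed.

Lemma color_bnodes B x c : uniq (blabels B) -> (x, c) \in bnodes B ->
  c = ((x, black) \in bnodes B).
Proof.
move=> uB; case: c => [->//|xw]; apply/esym/negP=> xb.
by have := uniq_fst_inj uB xw xb.
Qed.

Definition Ebi : classical_sets.set (bintree 'I_n) := fun B => Bbi B /\ ordered B.

Lemma uniq_blabels B : Bbi B -> uniq (blabels B).
Proof. by move=> pB; rewrite (perm_uniq pB) enum_uniq. Qed.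

Lemma set_bij_flip : set_bij (@Dbi n) Ebi (@flip_right_improper n).
Proof.
split.
- move=> B [pB _]; rewrite flip_right_improperE ?uniq_blabels //; split.
    exact: perm_trans (blabels_flip_where _ _) pB.
  exact/flip_misordered_ordered/uniq_blabels.
- move=> B B' /set_mem[pB bB] /set_mem[pB' bB'].
  rewrite !flip_right_improperE ?uniq_blabels // => /(congr1 (flip_where (@white_improper n))).
  by rewrite !flip_misorderedK //; apply/improper_blackP => //; apply: uniq_blabels.
move=> B [pB oB]; have pU : Bbi (flip_where (@white_improper n) B).
  exact: perm_trans (blabels_flip_where _ _) pB.
exists (flip_where (@white_improper n) B); last first.
  by rewrite flip_right_improperE ?unflipK // uniq_blabels.
by split=> //; apply/improper_blackP; rewrite ?uniq_blabels // unflip_improper_black.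
Qed.

Lemma set_bij_graph : set_bij Ebi (@Fbi n) (@gamma n \o @phi n).
Proof.
split.
- move=> B [pB _]; have cardE := edges_gamma_card (uniq_blabels pB).
  have FB := realizes_forest (@adj_sym _ _) (realizes_gamma pB).
  exact: (iffRL (is_forestP (gamma (phi B))) (conj cardE FB)).
- move=> B B' /set_mem[pB oB] /set_mem[pB' oB'] /= eqF.
  have := realizes_gamma pB'; rewrite -eqF => rB'.
  apply: (realizes_unique (col := color (gamma (phi B))) (@adj_sym _ _)
    (realizes_gamma pB) rB' oB oB').
  + by move=> x c /(color_bnodes (uniq_blabels pB)) ->; rewrite color_gamma.
  by move=> x c /(color_bnodes (uniq_blabels pB')) ->; rewrite eqF color_gamma.
move=> F /is_forestP[E2 FF].
have [B [[uniqB labB adjB rootB] oB cB]] :=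
  realizes_exists (@adj_sym _ F) (adj_irr E2) (color F) FF.
have pB : Bbi B.
  by apply: uniq_perm; rewrite ?enum_uniq // => u; rewrite labB mem_enum !inE.
exists B; first by split.
apply: rgraph_eq => //=.
- by move=> e; apply: edges_gamma_card.
- by move=> x y; rewrite [LHS]adj_gamma adjB ?inE.
- by apply/setP=> u; rewrite -roots_gamma rootB.
move=> v; rewrite [LHS]color_gamma.
have : v \in blabels B by rewrite labB inE.
case/mapP=> -[u c] uc /= ->; rewrite -(cB _ _ uc).
by rewrite -(color_bnodes uniqB uc).
Qed.

End Graphs.

Theorem theorem4 (n : nat) (hn : 1 <= n) :
  set_bij (@Dbi n) (@Fbi n) (@gamma n \o @phi n \o @flip_right_improper n).
Proof. exact: set_bij_comp (@set_bij_flip n) (@set_bij_graph n). Qed.
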